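(* Let $\mathcal{M}$ be a countably infinite structure over a countable language and suppose that $\mathcal{M}$ is not $\omega$-categorical. Then $\mathcal{M}$ has $2^{\aleph_0}$ distinct group-reducts up to interdefinability; that is, there are $2^{\aleph_0}$ structures $\mathcal{M}'$ with the same domain as $\mathcal{M}$ and with $\mathrm{Aut}(\mathcal{M}')\supseteq\mathrm{Aut}(\mathcal{M})$, no two of which are interdefinable.
   Context: Here a *group-reduct* of $\mathcal{M}$ is a structure $\mathcal{M}'$ with the same domain as $\mathcal{M}$ such that $\mathrm{Aut}(\mathcal{M}')\supseteq\mathrm{Aut}(\mathcal{M})$. Two group-reducts $\mathcal{M}_1,\mathcal{M}_2$ are *interdefinable* (and are identified in this statement) if each is $\emptyset$-definable in the other, i.e. if they have the same first-order definable-without-parameters relations. A structure is $\omega$-categorical if its complete first-order theory has, up to isomorphism, exactly one countably infinite model. *)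

(* Defs.v *)
From HB Require Import structures.
From mathcomp Require Import all_boot.
From mathcomp Require Import boolp classical_sets functions cardinality.

Set Implicit Arguments.
Unset Strict Implicit.
Unset Printing Implicit Defensive.

Local Open Scope classical_set_scope.
Local Open Scope card_scope.

Definition countably_infinite (A : Type) : Prop := [set: A] #= [set: nat].

(* Constants are function symbols of arity 0. *)
Record language := Language {
  fsym : Type;
  farity : fsym -> nat;
  rsym : Type;
  rarity : rsym -> nat
}.

Definition countable_language (L : language) : Prop :=
  countable [set: fsym L] /\ countable [set: rsym L].

(* n-tuples of elements of A are functions 'I_n -> A. *)
Record structure (L : language) (A : Type) := Structure {
  fint : forall f : fsym L, ('I_(farity f) -> A) -> A;
  rint : forall r : rsym L, ('I_(rarity r) -> A) -> Prop
}.

(* Well-scoped syntax: the free variables of an element of [term L n] or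
   [formula L n] are among x_0, ..., x_(n-1). In [All phi] the bound variable
   is x_0 of phi, and x_(i+1) of phi is x_i of [All phi]. *)
Inductive term (L : language) (n : nat) : Type :=
| Var of 'I_n
| App (f : fsym L) of ('I_(farity f) -> term L n).

Inductive formula (L : language) : nat -> Type :=
| Bot n : formula L n
| Eq n of term L n & term L n : formula L n
| Rel n (r : rsym L) of ('I_(rarity r) -> term L n) : formula L n
| Imp n of formula L n & formula L n : formula L n
| All n of formula L n.+1 : formula L n.

Definition sentence (L : language) : Type := formula L 0.

Definition tcons (A : Type) (n : nat) (x : A) (a : 'I_n -> A) : 'I_n.+1 -> A :=
  fun i => if unlift ord0 i is Some j then a j else x.

Fixpoint eval (L : language) (A : Type) (M : structure L A) (n : nat)
    (a : 'I_n -> A) (t : term L n) : A :=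
  match t with
  | Var i => a i
  | App f ts => fint M (fun i => eval M a (ts i))
  end.

Fixpoint sat (L : language) (A : Type) (M : structure L A) (n : nat)
    (phi : formula L n) : ('I_n -> A) -> Prop :=
  match phi in formula _ m return ('I_m -> A) -> Prop with
  | Bot _ => fun _ => False
  | Eq _ t u => fun a => eval M a t = eval M a u
  | Rel _ r ts => fun a => rint M (fun i => eval M a (ts i))
  | Imp _ p q => fun a => sat M p a -> sat M q a
  | All _ p => fun a => forall x : A, sat M p (tcons x a)
  end.

Definition true_in (L : language) (A : Type) (M : structure L A)
    (phi : sentence L) : Prop :=
  forall a : 'I_0 -> A, sat M phi a.

Definition theory (L : language) (A : Type) (M : structure L A) :
    set (sentence L) :=
  [set phi | true_in M phi].

Definition models (L : language) (A : Type) (M : structure L A)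
    (T : set (sentence L)) : Prop :=
  forall phi, T phi -> true_in M phi.

Definition isomorphism (L : language) (A B : Type)
    (M : structure L A) (N : structure L B) (g : A -> B) : Prop :=
  [/\ bijective g,
      forall (f : fsym L) (a : 'I_(farity f) -> A),
        g (fint M a) = fint N (g \o a) &
      forall (r : rsym L) (a : 'I_(rarity r) -> A),
        rint M a <-> rint N (g \o a)].

Definition isomorphic (L : language) (A B : Type)
    (M : structure L A) (N : structure L B) : Prop :=
  exists g : A -> B, isomorphism M N g.

Definition automorphism (L : language) (A : Type) (M : structure L A)
    (g : A -> A) : Prop :=
  isomorphism M M g.

Definition omega_categorical (L : language) (A : Type) (M : structure L A) :
    Prop :=
  exists (B : Type) (N : structure L B),
    [/\ countably_infinite B,
        models N (theory M) &
        forall (C : Type) (P : structure L C),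
          countably_infinite C -> models P (theory M) -> isomorphic N P].

Definition definable (L : language) (A : Type) (M : structure L A)
    (n : nat) (R : ('I_n -> A) -> Prop) : Prop :=
  exists phi : formula L n, forall a : 'I_n -> A, R a <-> sat M phi a.

(* M1 and M2 live on the same domain but may have different languages. *)
Definition interdefinable (L1 L2 : language) (A : Type)
    (M1 : structure L1 A) (M2 : structure L2 A) : Prop :=
  forall (n : nat) (R : ('I_n -> A) -> Prop),
    definable M1 R <-> definable M2 R.

Definition group_reduct (L L' : language) (A : Type)
    (M : structure L A) (M' : structure L' A) : Prop :=
  forall g : A -> A, automorphism M g -> automorphism M' g.

(* Main.v *)
Require Import Defs.
From HB Require Import structures.
From mathcomp Require Import all_boot.
From mathcomp Require Import boolp classical_sets functions cardinality.

(** Suppose that, for every n, only finitely many n-types are realised in M.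
Then each of these types is isolated among them by a single formula, and the
sentences expressing the isolation and the exhaustiveness of the list hold in
every model of the theory of M.  This is what both halves of a back-and-forth
argument need ([forth], [back]), so every countable model is isomorphic to M
([finitely_many_types_omega_categorical]).  This is the half of the
Ryll-Nardzewski theorem used here.

Hence, if M is not omega-categorical, infinitely many n-types p_0, p_1, ... are
realised for some n.  A union of sets of realisations of types is invariant
under Aut(M), so every s : set nat gives a group-reduct each of whose basic
relations is empty or R_s = {a | tp(a) is one of the p_i, i in s}, and s is
determined by R_s.  A structure in a countable language has only countably many definable
relations, so each interdefinability class contains countably many of these
reducts ([many_types_reducts]).  An argument in the style of Koenig's theorem
turns a map on [set nat] with countable fibres into continuum many values
([countable_fibres_card]), so there are at least continuum many classes.

Conversely every structure in a countable language is interdefinable with one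
whose basic relations are its numbered definable relations
([relational_normal_form]).  These structures share one countable relational
language and inject into [set nat] when the domain is countable, so there are
at most continuum many classes.  The Cantor-Bernstein theorem then provides a
bijection between [set nat] and the classes. *)

Set Implicit Arguments.
Unset Strict Implicit.
Unset Printing Implicit Defensive.

Local Open Scope classical_set_scope.
Local Open Scope card_scope.

(** * Tuples *)

Lemma tcons0 (T : Type) n (x : T) (a : 'I_n -> T) : tcons x a ord0 = x.
Proof. by rewrite /tcons unlift_none. Qed.

Lemma tcons_lift (T : Type) n (x : T) (a : 'I_n -> T) (i : 'I_n) :
  tcons x a (lift ord0 i) = a i.
Proof. by rewrite /tcons liftK. Qed.

Lemma tcons_eta (T : Type) n (a : 'I_n.+1 -> T) :
  a = tcons (a ord0) (a \o lift ord0).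
Proof.
apply/funext => i; case: (unliftP ord0 i) => [j|] ->.
  by rewrite tcons_lift.
by rewrite tcons0.
Qed.

Lemma comp_tcons (T U : Type) (g : T -> U) n (x : T) (a : 'I_n -> T) :
  g \o tcons x a = tcons (g x) (g \o a).
Proof.
apply/funext => i; case: (unliftP ord0 i) => [j|] -> /=.
  by rewrite !tcons_lift.
by rewrite !tcons0.
Qed.

Lemma tuple0_unique (T : Type) (a b : 'I_0 -> T) : a = b.
Proof. by apply/funext => -[]. Qed.

(** * Satisfaction and logical connectives *)

Definition Top L n : formula L n := Imp (Bot L n) (Bot L n).
Definition Neg L n (p : formula L n) : formula L n := Imp p (Bot L n).
Definition And L n (p q : formula L n) : formula L n := Neg (Imp p (Neg q)).
Definition Ex L n (p : formula L n.+1) : formula L n := Neg (All (Neg p)).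

Lemma sat_Neg L A (M : structure L A) n (p : formula L n) a :
  sat M (Neg p) a <-> ~ sat M p a.
Proof. by []. Qed.

Lemma sat_And L A (M : structure L A) n (p q : formula L n) a :
  sat M (And p q) a <-> sat M p a /\ sat M q a.
Proof.
split=> [/= h|[hp hq] /=]; last by apply.
by split; apply: contrapT => h'; apply: h => hp hq; apply: h'.
Qed.

Lemma sat_Ex L A (M : structure L A) n (p : formula L n.+1) a :
  sat M (Ex p) a <-> exists x, sat M p (tcons x a).
Proof.
split=> [/= h|[x hx] /= h]; last exact: h hx.
by apply: contrapT => nex; apply: h => x hx; apply: nex; exists x.
Qed.

(** The connective is provided by its meaning in all structures at once, because
the back-and-forth argument reads the same formula in two structures. *)
Lemma finite_conjunction L n k (F : 'I_k -> formula L n) :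
  exists phi : formula L n, forall A (M : structure L A) a,
    sat M phi a <-> forall i, sat M (F i) a.
Proof.
elim: k F => [|k IH] F.
  by exists (Top L n) => A M a; split=> // _ [].
have [phi hphi] := IH (F \o lift ord0).
exists (And (F ord0) phi) => A M a; rewrite sat_And hphi; split.
  by move=> [h0 h] i; case: (unliftP ord0 i) => [j|] ->; [exact: h|].
by move=> h; split=> // i; exact: h.
Qed.

Lemma finite_disjunction L n k (F : 'I_k -> formula L n) :
  exists phi : formula L n, forall A (M : structure L A) a,
    sat M phi a <-> exists i, sat M (F i) a.
Proof.
have [phi hphi] := finite_conjunction (fun i => Neg (F i)).
exists (Neg phi) => A M a; rewrite sat_Neg hphi; split; last first.
  by move=> [i hi] h; exact: h hi.
by move=> h; apply: contrapT => nex; apply: h => i hi; apply: nex; exists i.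
Qed.

Lemma universal_closure L n (phi : formula L n) :
  exists psi : sentence L, forall A (M : structure L A),
    true_in M psi <-> forall a, sat M phi a.
Proof.
elim: n phi => [|n IH] phi; first by exists phi.
have [psi hpsi] := IH (All phi); exists psi => A M; rewrite hpsi; split.
  by move=> h a; rewrite (tcons_eta a); exact: h.
by move=> h a x; exact: h.
Qed.

Fixpoint rename_term L m n (sigma : 'I_m -> 'I_n) (t : term L m) : term L n :=
  match t with
  | Var i => Var L (sigma i)
  | App f ts => App (fun i => rename_term sigma (ts i))
  end.

Lemma eval_rename L A (M : structure L A) m n (sigma : 'I_m -> 'I_n) t a :
  eval M a (rename_term sigma t) = eval M (a \o sigma) t.
Proof.
elim: t => [//|f ts IH] /=; congr fint; exact/funext.
Qed.

(** Under a quantifier the renaming is extended by fixing the bound variable. *)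
Lemma rename_formula L m (phi : formula L m) n (sigma : 'I_m -> 'I_n) :
  exists psi : formula L n, forall A (M : structure L A) a,
    sat M psi a <-> sat M phi (a \o sigma).
Proof.
elim: phi n sigma => {m} [m|m t u|m r ts|m p IHp q IHq|m p IHp] n sigma.
- by exists (Bot L n).
- exists (Eq (rename_term sigma t) (rename_term sigma u)) => A M a /=.
  by rewrite !eval_rename.
- exists (Rel (fun i => rename_term sigma (ts i))) => A M a /=.
  by under eq_fun do rewrite eval_rename.
- have [p' hp] := IHp _ sigma; have [q' hq] := IHq _ sigma.
  by exists (Imp p' q') => A M a /=; rewrite hp hq.
- pose tau := tcons ord0 (lift ord0 \o sigma).
  have [p' hp] := IHp _ tau; exists (All p') => A M a /=.
  have etau x : tcons x a \o tau = tcons x (a \o sigma).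
    rewrite comp_tcons tcons0; congr tcons.
    by apply/funext => i /=; rewrite tcons_lift.
  by split=> h x; move: (h x); rewrite hp etau.
Qed.

(** * Complete types *)

Definition tp L A (M : structure L A) n (a : 'I_n -> A) : set (formula L n) :=
  [set phi | sat M phi a].

(** Complete types are maximal: a formula of [tp N b] outside [tp M a] would have
its negation in [tp M a]. *)
Lemma tp_sub_eq L A B (M : structure L A) (N : structure L B) n
    (a : 'I_n -> A) (b : 'I_n -> B) :
  tp M a `<=` tp N b -> tp M a = tp N b.
Proof.
move=> sub; apply/seteqP; split=> // phi hb; apply: contrapT => ha.
exact: (sub (Neg phi) ha) hb.
Qed.

Definition finitely_many_types L A (M : structure L A) : Prop :=
  forall n, finite_set (range (@tp L A M n)).

(** Each of the finitely many other realised types omits some formula of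
[tp M a]; the conjunction of these formulas excludes all of them. *)
Lemma isolating_formula L A (M : structure L A) n (a : 'I_n -> A) :
  finite_set (range (@tp L A M n)) ->
  exists phi, sat M phi a /\ forall b, sat M phi b -> tp M b = tp M a.
Proof.
move=> /finite_seqP[X hX].
have sep (i : 'I_(size X)) : exists phi, sat M phi a /\
    (tnth (in_tuple X) i <> tp M a -> ~ tnth (in_tuple X) i phi).
  have [->|ne] := pselect (tnth (in_tuple X) i = tp M a).
    by exists (Top L n); split=> //; apply.
  have [b _ eb] : range (@tp L A M n) (tnth (in_tuple X) i).
    by rewrite hX /=; exact: mem_tnth.
  (* A realised type that contains the whole of [tp M a] is equal to it. *)
  rewrite -eb in ne *; apply: contrapT => nex; apply: ne.
  apply/esym; apply: tp_sub_eq => phi hphi; apply: contrapT => hb.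
  by apply: nex; exists phi.
have [F hF] := choice sep; have [phi hphi] := finite_conjunction F.
exists phi; split; first by apply/hphi => i; case: (hF i).
move=> b /hphi hb.
have hin : tp M b \in X.
  by have : range (@tp L A M n) (tp M b); [exists b|rewrite hX].
have /tnthP[i ei] : tp M b \in in_tuple X by [].
apply: contrapT => ne; case: (hF i) => _ /(_ _); rewrite -ei => /(_ ne).
by apply; exact: hb.
Qed.

(** * Building sequences by finite approximations *)

(** The first n entries are listed latest first, so that appending an entry to the
sequence is a [tcons] on the tuple; hence the reversed index. *)
Definition initial T (u : nat -> T) n : 'I_n -> T := fun i => u (n - i.+1)%N.
Arguments initial {T} u n i.

Lemma initialS T (u : nat -> T) n : initial u n.+1 = tcons (u n) (initial u n).
Proof.
rewrite [LHS]tcons_eta; congr tcons; first by rewrite /initial subSS subn0.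
Qed.

(** Dependent choice along [tcons]: [P] is the invariant of the finite
approximations and [Q n] the task to be met by the n-th entry. *)
Lemma sequence_by_extension T (P : forall n, ('I_n -> T) -> Prop)
    (Q : nat -> T -> Prop) :
  (forall a : 'I_0 -> T, P 0%N a) ->
  (forall n (a : 'I_n -> T), P n a ->
     exists x, P n.+1 (tcons x a) /\ Q n x) ->
  exists u : nat -> T, forall n, P n (initial u n) /\ Q n (u n).
Proof.
move=> P0 PS.
have nil : 'I_0 -> T by case.
have [x0 _] := PS _ _ (P0 nil).
(* [x0] is a value for the tuples that do not satisfy the invariant. *)
have total n (a : 'I_n -> T) : exists x, P n a -> P n.+1 (tcons x a) /\ Q n x.
  by have [/PS[x hx]|nPa] := pselect (P n a); [exists x|exists x0].
have [step hstep] :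
    exists s : forall n, ('I_n -> T) -> T,
      forall n a, P n a -> P n.+1 (tcons (s n a) a) /\ Q n (s n a).
  by exists (fun n a => sval (cid (total n a))) => n a; case: cid.
pose pre := fix pre n : 'I_n -> T :=
  if n is m.+1 then tcons (step m (pre m)) (pre m) else nil.
pose u n := step n (pre n); exists u.
have eu n : initial u n = pre n.
  by elim: n => [|n IH]; [exact: tuple0_unique|rewrite initialS IH].
have hP n : P n (pre n).
  by elim: n => [|n IH] /=; [exact: P0|case: (hstep _ _ IH)].
by move=> n; rewrite eu; split=> //; case: (hstep _ _ (hP n)).
Qed.

(** * Finitely many realised types force omega-categoricity *)

Lemma surjective_enumeration T : countably_infinite T ->
  exists e : nat -> T, forall x, exists n, e n = x.
Proof.
move=> /card_bijP[f [g fK gK]].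
exists (fun n => set_val (g (to_setT n))) => x.
exists (set_val (f (to_setT x))).
rewrite (_ : to_setT _ = f (to_setT x)) ?fK //.
exact: val_inj.
Qed.

Section BackAndForth.
Context (L : language) (A C : Type) (M : structure L A) (P : structure L C).
Hypothesis finM : finitely_many_types M.
Hypothesis modP : models P (theory M).

Lemma valid_transfer n (phi : formula L n) :
  (forall a, sat M phi a) -> forall c, sat P phi c.
Proof.
by have [psi hpsi] := universal_closure phi => /hpsi/modP/hpsi.
Qed.

Lemma tp_nil (a : 'I_0 -> A) (c : 'I_0 -> C) : tp M a = tp P c.
Proof.
apply: tp_sub_eq => phi ha; apply: valid_transfer => a'.
by rewrite (tuple0_unique a' a).
Qed.

(** The implications from an isolating formula to the other formulas of the type
are valid in M, hence in P, where the formula therefore isolates the same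
type. *)
Lemma isolating_transfer n phi (a : 'I_n -> A) (c : 'I_n -> C) :
  (forall b, sat M phi b -> tp M b = tp M a) -> sat P phi c ->
  tp M a = tp P c.
Proof.
move=> iso hc; apply: tp_sub_eq => psi ha.
apply: (@valid_transfer _ (Imp phi psi)) hc => b /iso eb.
by change (tp M b psi); rewrite eb.
Qed.

(** The formula isolating the type of the extended tuple has a witness over [a],
a fact recorded in [tp M a]. *)
Lemma forth n (a : 'I_n -> A) (c : 'I_n -> C) x : tp M a = tp P c ->
  exists y, tp M (tcons x a) = tp P (tcons y c).
Proof.
move=> e; have [phi [hphi iso]] := isolating_formula (tcons x a) (finM n.+1).
have : tp M a (Ex phi) by apply/sat_Ex; exists x.
rewrite e => /sat_Ex[y hy]; exists y; exact: isolating_transfer iso hy.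
Qed.

(** An element of P might realise a new type over [c]; this is excluded because
the disjunction of the finitely many isolating formulas is valid in M and so
in P. *)
Lemma back n (a : 'I_n -> A) (c : 'I_n -> C) y : tp M a = tp P c ->
  exists x, tp M (tcons x a) = tp P (tcons y c).
Proof.
move=> e; have [X hX] := (@finite_seqP _ _).1 (finM n.+1).
have hrep (i : 'I_(size X)) :
    exists b, tp M b = tnth (in_tuple X) i.
  have [b _ eb] : range (@tp L A M n.+1) (tnth (in_tuple X) i).
    by rewrite hX /=; exact: mem_tnth.
  by exists b.
have [b hb] := choice hrep.
have [F hF] := choice (fun i => isolating_formula (b i) (finM n.+1)).
have [phi hphi] := finite_disjunction F.
have /hphi[i hi] : sat P phi (tcons y c).
  apply: valid_transfer => d; apply/hphi.
  have : tp M d \in in_tuple X.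
    by have : range (@tp L A M n.+1) (tp M d); [exists d|rewrite hX].
  move=> /tnthP[i ei]; exists i.
  by change (tp M d (F i)); rewrite ei -hb; case: (hF i).
have : tp P c (Ex (F i)) by apply/sat_Ex; exists y.
rewrite -e => /sat_Ex[x hx]; exists x.
case: (hF i) => _ iso; rewrite (iso _ hx); exact: isolating_transfer iso hi.
Qed.

(** Even stages take care of the next element of A and odd stages of the next
element of C. *)
Lemma matching_enumerations (eA : nat -> A) (eC : nat -> C) :
  exists (u : nat -> A) (v : nat -> C),
    (forall n, tp M (initial u n) = tp P (initial v n)) /\
    forall n, (exists k, u k = eA n) /\ (exists k, v k = eC n).
Proof.
have [|n w e|uv huv] := @sequence_by_extension (A * C)
  (fun n w => tp M (fst \o w) = tp P (snd \o w))
  (fun n p => if odd n then p.2 = eC n./2 else p.1 = eA n./2).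
- by move=> w; exact: tp_nil.
- case: (odd n).
    have [x hx] := back (eC n./2) e; exists (x, eC n./2).
    by rewrite !comp_tcons.
  have [y hy] := forth (eA n./2) e; exists (eA n./2, y).
  by rewrite !comp_tcons.
exists (fst \o uv), (snd \o uv); split; first by move=> n; case: (huv n).
move=> n; split.
  by exists n.*2; case: (huv n.*2) => _; rewrite odd_double doubleK.
by exists n.*2.+1; case: (huv n.*2.+1) => _ /=; rewrite odd_double uphalf_double.
Qed.

(** Renaming variables frees the agreement of types from the order in which
[initial] lists the enumerations. *)
Lemma matching_transfer (u : nat -> A) (v : nat -> C) :
  (forall n, tp M (initial u n) = tp P (initial v n)) ->
  forall k (s : 'I_k -> nat), tp M (u \o s) = tp P (v \o s).
Proof.
move=> e k s; pose n := (\max_(i < k) s i).+1.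
have lt_sn i : (s i < n)%N by rewrite ltnS; exact: (leq_bigmax i).
pose sigma i := rev_ord (Ordinal (lt_sn i)).
have initial_sigma T (w : nat -> T) : initial w n \o sigma = w \o s.
  by apply/funext => i; rewrite /initial /= subnSK // subKn // ltnW.
apply: tp_sub_eq => phi; have [psi hpsi] := rename_formula phi sigma.
rewrite /tp /= -!initial_sigma => /hpsi hM; apply/hpsi.
by change (tp P (initial v n) psi); rewrite -e.
Qed.

Lemma elementary_surjection_isomorphism (g : A -> C) :
  (forall n (a : 'I_n -> A), tp M a = tp P (g \o a)) ->
  (forall y, exists x, g x = y) -> isomorphism M P g.
Proof.
move=> e sg.
have eP n phi (a : 'I_n -> A) : sat M phi a <-> sat P phi (g \o a).
  by change (tp M a phi <-> tp P (g \o a) phi); rewrite e.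
have [h hh] := choice sg.
have gI x y : g x = g y -> x = y.
  move=> gxy; have := eP _ (Eq (Var L (ord0 : 'I_2)) (Var L (lift ord0 ord0)))
    (tcons x (fun=> y)).
  by rewrite /= !tcons0 !tcons_lift => -[_]; apply.
split.
- by exists h => // x; apply: gI; rewrite hh.
- move=> f a.
  (* The value of [f] at [a] is recorded in the type of [(f a, a)]. *)
  have := eP _ (Eq (Var L ord0) (App (fun i => Var L (lift ord0 i))))
    (tcons (fint M a) a).
  rewrite comp_tcons /= !tcons0.
  under eq_fun do rewrite tcons_lift.
  by under [X in fint P X]eq_fun do rewrite tcons_lift; case=> -> //.
- by move=> r a; exact: (eP _ (Rel (fun i => Var L i)) a).
Qed.

Lemma isomorphic_of_types : countably_infinite A -> countably_infinite C ->
  isomorphic M P.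
Proof.
move=> cA cC.
have [eA hA] := surjective_enumeration cA; have [eC hC] := surjective_enumeration cC.
have [u [v [euv suv]]] := matching_enumerations eA eC.
have [ku hku] : {ku & forall x, u (ku x) = x}.
  apply: (@choice _ _ (fun x n => u n = x)) => x.
  by have [n <-] := hA x; exact: (suv n).1.
exists (v \o ku); apply: elementary_surjection_isomorphism => [n a|y].
  rewrite -(matching_transfer euv (ku \o a)); congr tp.
  by apply/funext => i /=; rewrite hku.
(* [ku (u k)] may differ from [k], but [v] agrees there because [u] does. *)
have [n <-] := hC y; have [k <-] := (suv n).2; exists (u k) => /=.
have := matching_transfer euv (tcons (ku (u k)) (fun _ : 'I_1 => k)).
move=> /(congr1 (fun p => p (Eq (Var L (ord0 : 'I_2)) (Var L (lift ord0 ord0))))).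
by rewrite /tp /= !tcons0 !tcons_lift hku => <-.
Qed.

End BackAndForth.

(** The half of the Ryll-Nardzewski theorem that goes from few types to
categoricity. *)
Lemma finitely_many_types_omega_categorical L A (M : structure L A) :
  countably_infinite A -> finitely_many_types M -> omega_categorical M.
Proof.
move=> cA finM; exists A, M; split=> // C P cC modP.
exact: isomorphic_of_types.
Qed.

(** * Countability of the set of formulas *)

Section FormulaCode.
Context (L : language) (cf : Defs.fsym L -> nat) (cr : rsym L -> nat).
Hypothesis cfI : injective cf.
Hypothesis crI : injective cr.

Fixpoint term_code n (t : term L n) : nat :=
  match t with
  | Var i => pickle (inl (val i) : nat + nat * seq nat)
  | App f ts => pickle (inr (cf f, [seq term_code (ts i) | i : 'I_(farity f)])
                  : nat + nat * seq nat)
  end.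

Fixpoint formula_code n (phi : formula L n) : nat :=
  match phi with
  | Bot _ => pickle (0, [::] : seq nat)
  | Eq _ t u => pickle (1, [:: term_code t; term_code u])
  | Rel _ r ts =>
      pickle (2, cr r :: [seq term_code (ts i) | i : 'I_(rarity r)])
  | Imp _ p q => pickle (3, [:: formula_code p; formula_code q])
  | All _ p => pickle (4, [:: formula_code p])
  end.

Lemma image_ord_inj (T : Type) k (f g : 'I_k -> T) :
  [seq f i | i : 'I_k] = [seq g i | i : 'I_k] -> f =1 g.
Proof.
elim/Peq : T f g => T f g.
by move=> /eq_in_map efg i; apply: efg; rewrite mem_enum.
Qed.

Lemma pickle_inj (T : countType) : injective (@pickle T).
Proof. exact: (pcan_inj pickleK). Qed.

Lemma term_code_inj n : injective (@term_code n).
Proof.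
elim=> [i|f ts IH] [j|g us] /= /pickle_inj //.
  by move=> [] /val_inj ->.
move=> [] /cfI efg; subst g => /image_ord_inj e.
by congr App; apply/funext => i; apply: IH; exact: e.
Qed.

Lemma formula_code_inj n : injective (@formula_code n).
Proof.
elim=> {n} [n|n t u|n r ts|n p IHp q IHq|n p IHp] phi.
- by case: phi => {n} [n|n t u|n r ts|n p q|n p] /= /pickle_inj.
- case: phi t u => {n} [n|n t' u'|n r' ts'|n p' q'|n p'] t u /= /pickle_inj //.
  by case=> /term_code_inj -> /term_code_inj ->.
- case: phi ts => {n} [n|n t' u'|n r' ts'|n p' q'|n p'] ts /= /pickle_inj //.
  case=> /crI er; subst r' => /image_ord_inj e; congr Rel.
  by apply/funext => i; apply: term_code_inj; exact: e.
- case: phi p IHp q IHq => {n} [n|n t' u'|n r' ts'|n p' q'|n p'] p IHp q IHq /=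
    /pickle_inj //.
  by case=> /IHp -> /IHq ->.
- case: phi p IHp => {n} [n|n t' u'|n r' ts'|n p' q'|n p'] p IHp /= /pickle_inj //.
  by case=> /IHp ->.
Qed.

End FormulaCode.

Lemma formula_numbering L : countable_language L ->
  exists code : forall n, formula L n -> nat, forall n, injective (code n).
Proof.
move=> [/countable_injP[cf cfI] /countable_injP[cr crI]].
exists (@formula_code L cf cr) => n; apply: formula_code_inj.
  by move=> f g; apply: cfI; rewrite inE.
by move=> f g; apply: crI; rewrite inE.
Qed.

(** * Structures in a fixed relational language *)

(** One language for all reducts: countably many relation symbols [(n, i)] of
each arity [n], and no function symbols. *)
Definition relations_language : language :=
  @Language void (fun f => match f with end) (nat * nat) fst.

Definition relational_structure A (R : forall r : nat * nat, ('I_r.1 -> A) -> Prop) :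
    structure relations_language A :=
  @Structure relations_language A (fun f => match f with end) R.

Lemma countable_relations_language : countable_language relations_language.
Proof. by split; exact: countableP. Qed.

Lemma relational_structure_eq A (N N' : structure relations_language A) :
  (forall r a, rint N (r := r) a <-> rint N' (r := r) a) -> N = N'.
Proof.
case: N N' => [f R] [f' R'] /= e.
have -> : f = f' by apply: functional_extensionality_dep => -[].
congr Structure; apply: functional_extensionality_dep => r; apply/funext => a.
exact/propext.
Qed.

(** A structure is the set of the facts that hold in it, and a fact is a natural
number once the domain is numbered. *)
Lemma relational_structures_card A : countable [set: A] ->
  [set: structure relations_language A] #<= [set: set nat].
Proof.
move=> /countable_injP[c cI0].
have cI : injective c by move=> x y; apply: cI0; rewrite inE.
pose code (N : structure relations_language A) : set nat :=
  [set k | exists (r : nat * nat) (a : 'I_r.1 -> A),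
     k = pickle (r, [seq c (a i) | i : 'I_r.1]) /\ rint N (r := r) a].
have code_sub N N' : code N `<=` code N' ->
    forall r a, rint N (r := r) a -> rint N' (r := r) a.
  move=> sub r a hr.
  have [r' [a' [/pickle_inj[er] ea hr']]] :
    code N' (pickle (r, [seq c (a i) | i : 'I_r.1])) by apply: sub; exists r, a.
  move: ea hr'; case: r' / er a' => a' /image_ord_inj ea.
  by rewrite (_ : a' = a) //; apply/funext => i; apply/esym/cI; exact: ea.
apply/pcard_injP; exists code => N N' _ _ e.
apply: relational_structure_eq => r a; split; apply: code_sub; by rewrite e.
Qed.

Lemma sat_isomorphism L A B (M : structure L A) (N : structure L B) g :
  isomorphism M N g -> forall n (phi : formula L n) a,
    sat M phi a <-> sat N phi (g \o a).
Proof.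
move=> [[h gK hK] gf gr].
have ge n (t : term L n) a : g (eval M a t) = eval N (g \o a) t.
  by elim: t => [//|f ts IH] /=; rewrite gf; congr fint; exact/funext.
move=> n; elim=> {n} [n|n t u|n r ts|n p IHp q IHq|n p IHp] a //=.
- rewrite -!ge; split=> [->//|]; exact: can_inj gK _ _.
- rewrite gr (_ : g \o _ = fun i => eval N (g \o a) (ts i)) //.
  by apply/funext => i /=.
- by rewrite IHp IHq.
- split=> hp x; last by rewrite IHp comp_tcons.
  by move: (hp (h x)); rewrite IHp comp_tcons hK.
Qed.

(** Without function symbols every atomic formula over N' is an equality of
variables or a basic relation at a tuple of variables, so only renaming of variables is needed to translate it. *)
Lemma definable_relational L A (N : structure L A)
    (N' : structure relations_language A) :
  (forall r, definable N (fun a => rint N' (r := r) a)) ->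
  forall n (R : ('I_n -> A) -> Prop), definable N' R -> definable N R.
Proof.
move=> hr.
have var n (t : term relations_language n) : exists i, t = Var _ i.
  by case: t => [i|[]]; exists i.
have translate n (phi : formula relations_language n) :
    exists psi : formula L n, forall a, sat N psi a <-> sat N' phi a.
  elim: phi => {n} [n|n t u|n r ts|n p [p' hp] q [q' hq]|n p [p' hp]].
  - by exists (Bot L n).
  - have [i ->] := var _ t; have [j ->] := var _ u.
    by exists (Eq (Var L i) (Var L j)).
  - have [sigma hsigma] := choice (fun i => var _ (ts i)).
    have [phi hphi] := hr r; have [psi hpsi] := rename_formula phi sigma.
    exists psi => a; rewrite hpsi -hphi /=.
    by under [X in _ <-> rint _ X]eq_fun do rewrite hsigma.
  - by exists (Imp p' q') => a /=; rewrite hp hq.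
  - by exists (All p') => a /=; split=> h x; apply/hp; exact: h.
move=> n R [phi hphi]; have [psi hpsi] := translate _ phi.
by exists psi => a; rewrite hphi hpsi.
Qed.

(** The symbol [(n, i)] is interpreted as the relation defined by the n-ary formula
with number [i], or as the empty relation when [i] is not the number of such a
formula. *)
Lemma relational_normal_form L A (N : structure L A) : countable_language L ->
  exists N' : structure relations_language A,
    interdefinable N N' /\ group_reduct N N'.
Proof.
move=> /formula_numbering[code codeI].
pose N' := relational_structure (A := A) (fun r a =>
  exists phi, code r.1 phi = r.2 /\ sat N phi a).
exists N'; split.
  move=> n R; split; last first.
    apply: definable_relational => r.
    have [[phi ephi]|nex] := pselect (exists phi, code r.1 phi = r.2).
      exists phi => a /=; split=> [[phi' [e]]|]; last by exists phi.
      by rewrite (codeI _ phi' phi) // e ephi.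
    by exists (Bot L _) => a /=; split=> // -[phi [e _]]; apply: nex; exists phi.
  move=> [phi hphi].
  exists (@Rel relations_language n (n, code n phi) (fun i => Var _ i)) => a /=.
  rewrite hphi; split=> [h|[phi' [/codeI -> //]]]; by exists phi.
move=> g hg; split=> [|[]|r a /=]; first by case: hg.
have hphi := sat_isomorphism hg.
split=> -[phi [e h]]; exists phi; split=> //.
  exact: (hphi _ phi a).1.
exact: (hphi _ phi a).2.
Qed.

(** * Maps with countable fibres *)

(** Number each fibre injectively and code a sequence F : nat -> set nat by a set of
naturals; then F is determined by the image of its code and by its index.  If
for each n some x_n were not the n-th term of any F of index n, the sequence
(x_n) would have no possible index.  So for some n the sequences of index n
have every set as n-th term, and f is injective on their codes. *)
Lemma countable_fibres_card (Y : Type) (f : set nat -> Y) :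
  (forall s, countable [set t | f t = f s]) -> [set: set nat] #<= range f.
Proof.
move=> cf.
pose join (F : nat -> set nat) : set nat :=
  [set k | exists i j, k = pickle (i, j) /\ F i j].
have joinI F G : join F = join G -> F = G.
  move=> e; apply/funext => i; apply/funext => j; apply/propext.
  have sub F' G' : join F' `<=` join G' -> F' i j -> G' i j.
    move=> s h; have [i' [j' [/pickle_inj[-> ->]]]] // : join G' (pickle (i, j)).
    by apply: s; exists i, j.
  by split; apply: sub; rewrite e.
have [idx hidx] : exists idx : set nat -> nat,
    forall s t, f s = f t -> idx s = idx t -> s = t.
  have num s : exists h : set nat -> nat,
      forall t t', f t = f s -> f t' = f s -> h t = h t' -> t = t'.
    have /countable_injP[h hI] := cf s; exists h => t t' et et'.
    by apply: hI; rewrite inE.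
  have rep y : exists h : set nat -> nat,
      forall t t', f t = y -> f t' = y -> h t = h t' -> t = t'.
    have [[s <-]|ny] := pselect (exists s, f s = y); first exact: num.
    by exists (fun=> 0) => t t' et; case: ny; exists t.
  have [h hh] := choice rep; exists (fun s => h (f s) s) => s t e.
  by rewrite e; exact: (hh (f t)).
have [n hn] : exists n, forall x, exists F, idx (join F) = n /\ F n = x.
  apply: contrapT => nex.
  have avoid n : exists x, forall F, idx (join F) = n -> F n <> x.
    apply: contrapT => nx; apply: nex; exists n => x; apply: contrapT => nF.
    by apply: nx; exists x => F e1 e2; apply: nF; exists F.
  have [F hF] := choice avoid; exact: (hF _ F erefl) erefl.
have [k hk] := choice hn.
have kI : injective (fun x => f (join (k x))).
  move=> x y e; have [ix kx] := hk x; have [iy ky] := hk y.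
  rewrite -kx -ky; congr (_ n); apply: joinI; apply: hidx e _.
  by rewrite ix iy.
apply: (@card_le_trans _ _ _ (range (fun x => f (join (k x))))); last first.
  by apply: subset_card_le => _ [x _ <-]; exists (join (k x)).
have /card_eqPle[] // := inj_card_eq (A := [set: set nat]) (in2W kI).
Qed.

(** * Reducts from infinitely many types *)

(** If [N t] is interdefinable with [N s] then [R t] is defined by some formula in
[N s], and [R t] determines [t]; formulas being countable in number, so are the
possible [t].  In [N s] every n-ary symbol stands for [R s], though [(n, 0)]
alone would make it definable: this saves a case distinction on the number. *)
Lemma many_types_reducts L A (M : structure L A) :
  ~ finitely_many_types M ->
  exists N : set nat -> structure relations_language A,
    (forall s, group_reduct M (N s)) /\
    forall s, countable [set t | interdefinable (N t) (N s)].
Proof.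
move=> /existsNP[n /infiniteP/pcard_leP[p]].
pose R (s : set nat) (a : 'I_n -> A) := exists2 i, s i & tp M a = p i.
have RI s t : (forall a, R s a <-> R t a) -> s = t.
  have sub s' t' : (forall a, R s' a -> R t' a) -> s' `<=` t'.
    move=> h i si; have [a _ ea] : range (@tp L A M n) (p i) by exact: funS.
    have [j tj] : R t' a by apply: h; exists i.
    by rewrite ea => /inj -> //; rewrite inE.
  by move=> e; apply/seteqP; split; apply: sub => a /e.
pose N s := relational_structure (A := A) (fun r =>
  if pselect (n = r.1) is left e then fun a => R s (a \o cast_ord e) else fun=> False).
exists N; split.
  move=> s g hg; split=> [|[]|r a]; first by case: hg.
  rewrite /=; case: pselect => // e.
  have etp : tp M (g \o (a \o cast_ord e)) = tp M (a \o cast_ord e).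
    apply/seteqP; split=> phi; rewrite /tp /=.
      exact: (sat_isomorphism hg phi (a \o cast_ord e)).2.
    exact: (sat_isomorphism hg phi (a \o cast_ord e)).1.
  by rewrite /R etp.
move=> s.
have [code codeI] := formula_numbering countable_relations_language.
have Rdef t : definable (N t) (R t).
  exists (@Rel relations_language n (n, 0) (fun i => Var _ i)) => a /=.
  case: pselect => // e; rewrite (_ : _ \o cast_ord e = a) //.
  by apply/funext => i /=; congr a; apply: val_inj.
have num t : exists phi, interdefinable (N t) (N s) ->
    forall a, R t a <-> sat (N s) phi a.
  have [e|ne] := pselect (interdefinable (N t) (N s)); last by exists (Bot _ n).
  by have [phi hphi] := (e _ _).1 (Rdef t); exists phi.
have [phi hphi] := choice num.
apply/countable_injP; exists (fun t => code n (phi t)) => t t'.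
rewrite !inE => et et' /codeI e; apply: RI => a.
by rewrite (hphi _ et) (hphi _ et') e.
Qed.

(** * The number of reducts *)

Theorem proposition5p3 (L : language) (A : Type) (M : structure L A)
    (hL : countable_language L) (hA : countably_infinite A)
    (hM : ~ omega_categorical M) :
  exists (L' : set nat -> language) (M' : forall s : set nat, structure (L' s) A),
    [/\ forall s, countable_language (L' s),
        forall s, group_reduct M (M' s),
        forall s t, s <> t -> ~ interdefinable (M' s) (M' t) &
        forall (K : language) (N : structure K A),
          countable_language K -> group_reduct M N ->
          exists s, interdefinable N (M' s)].
Proof.
pose cls (N : structure relations_language A) :=
  [set N' : structure relations_language A | interdefinable N N'].
have clsP N N' : cls N = cls N' <-> interdefinable N N'.
  split=> [e|e]; first by change (cls N N'); rewrite e => n R.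
  by apply/seteqP; split=> P h n R; split=> [/e/h|/h/e].
pose reducts : set (structure relations_language A) := [set N | group_reduct M N].
have /card_set_bijP[f [fD fI fS]] : [set: set nat] #= cls @` reducts.
  apply/card_eqPle; split.
    have [N [redN cN]] := many_types_reducts
      (fun h => hM (finitely_many_types_omega_categorical hA h)).
    have := @countable_fibres_card _ (cls \o N) _.
    move=> /(_ _)/card_le_trans; apply.
      move=> s; apply: sub_countable (cN s); apply: subset_card_le => t.
      by move/clsP.
    by apply: subset_card_le => _ [s _ <-]; exists (N s); first exact: redN.
  apply: card_le_trans (card_image_le _ _) _.
  apply: card_le_trans (card_leT _) _; apply: relational_structures_card.
  by move: hA => /card_eqPle[].
have [M' hM'] : {M' & forall s, group_reduct M (M' s) /\ cls (M' s) = f s}.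
  by apply: (@choice _ _ (fun s N => group_reduct M N /\ cls N = f s)) => s;
     have [N] := fD s I; exists N.
exists (fun=> relations_language), M'; split.
- by move=> s; exact: countable_relations_language.
- by move=> s; case: (hM' s).
- move=> s t ne /clsP; rewrite (hM' s).2 (hM' t).2 => e.
  by apply: ne; apply: fI; rewrite ?inE.
- move=> K N cK redN; have [N' [idN redN']] := relational_normal_form N cK.
  have [s _ es] : (f @` setT) (cls N').
    by apply: fS; exists N' => // g /redN/redN'.
  exists s; have /clsP e : cls N' = cls (M' s) by rewrite (hM' s).2.
  by move=> n R; split=> [/idN/e|/e/idN].
Qed.
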